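(* Let $L\ge 1$ and $N_c\ge 1$ be integers and consider the uplink of the locally connected network with connectivity parameter $L$ described in the context, with cell association constraint $|\mathcal C_i|\le N_c$ for all $i$, restricted to zero-forcing message passing decoding schemes. Then the zero-forcing uplink per user degrees of freedom satisfy \[ \tau_U^{\mathrm{zf}}(L,N_c)=\begin{cases}1, & L+1\le N_c,\\[2pt] \dfrac{N_c+1}{L+2}, & \dfrac{L}{2}\le N_c\le L,\\[6pt] \dfrac{2N_c}{2N_c+L}, & 1\le N_c<\dfrac{L}{2}.\end{cases} \]
   Context: Network: $K$ base stations BS $1,\dots,K$ and $K$ mobile terminals MT $1,\dots,K$, each with a single antenna. For the connectivity parameter $L$, the channel coefficient $H_{i,j}$ between MT $i$ and BS $j$ is zero if and only if $i\notin\{j,j+1,\dots,j+L\}$; the nonzero coefficients are drawn from a continuous joint distribution (results hold for almost all realizations) and global channel state information is available everywhere. In the uplink, BS $j$ receives $Y_j=\sum_{i}H_{i,j}X_i+Z_j$, where $X_i$ is the signal of MT $i$ (average power constraint $P$) and $Z_j$ is unit-variance Gaussian noise. MT $i$ has message $W_i$. A cell association assigns to each MT $i$ a set $\mathcal C_i\subseteq[K]$ of base stations with $|\mathcal C_i|\le N_c$. Only whole (decoded) messages can be exchanged over the backhaul: a message $W_i$ may be decoded at one base station in $\mathcal C_i$ and passed to the other base stations in $\mathcal C_i$, which may use it to cancel its interference. Zero-forcing (message passing decoding) uplink scheme: each active MT uses a point-to-point Gaussian code of power $P$ and each active message gets one degree of freedom; BS $i$ is active if there is $j$ with $i\in\mathcal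 C_j$ such that, given the messages $B_i$ that BS $i$ has received over the backhaul (messages decoded elsewhere and associated with BS $i$), the noiseless received signal $Y_i-Z_i$ depends on $W_j$ and on no other message (i.e. all other interference is cancelled using $B_i$); then $W_j$ is decoded at BS $i$ and (MT $j$, BS $i$) is called a decoding pair. Each message is decoded at at most one base station. Degrees of freedom: $d_i=\lim_{P\to\infty}R_i(P)/\log P$, the sum DoF $\eta$ is the maximum of $\sum_i d_i$, and $\tau_U^{\mathrm{zf}}(L,N_c)=\lim_{K\to\infty}\eta_U^{\mathrm{zf}}(K,L,N_c)/K$, where $\eta_U^{\mathrm{zf}}(K,L,N_c)$ is the maximum uplink sum DoF over all cell associations satisfying the constraint and all zero-forcing message passing decoding schemes. *)

(* Defs.v *)
From mathcomp Require Import all_boot.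
From Stdlib Require Import Reals.

Set Implicit Arguments.
Unset Strict Implicit.
Unset Printing Implicit Defensive.

(* Indices are 0-based: MT j and BS i range over 'I_K.
   H_{j,i} <> 0  iff  i <= j <= i + L  (MT j is heard by BS i).
   For almost all channel realizations the noiseless signal of BS i
   depends exactly on the messages of the active MTs connected to it. *)
Definition connected (L : nat) (K : nat) (j i : 'I_K) : bool :=
  (i <= j <= i + L)%N.

(* Cell association: C j = set of BSs associated with MT j, |C j| <= Nc. *)
Definition assoc_ok (K Nc : nat) (C : {ffun 'I_K -> {set 'I_K}}) : bool :=
  [forall j, #|C j| <= Nc].

(* A zero-forcing (message passing decoding) uplink scheme:
   dec j = Some i  means W_j is decoded at BS i (MT j active, (j,i) a
   decoding pair); dec j = None means MT j is inactive (silent).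
   r is a decoding time (strict order of decoding), forbidding cyclic
   use of backhaul messages.  Condition for a decoding pair (j,i):
   i \in C j, W_j is heard at BS i, and every other active message m heard
   at BS i is in B_i, i.e. was decoded earlier at a BS k <> i and i \in C m. *)
Definition zf_valid (K L : nat) (C : {ffun 'I_K -> {set 'I_K}})
    (dec : {ffun 'I_K -> option 'I_K}) (r : {ffun 'I_K -> 'I_K}) : bool :=
  [forall j, forall i, (dec j == Some i) ==>
     [&& i \in C j, connected L j i &
       [forall m, [&& m != j, connected L m i & dec m != None] ==>
          [&& [exists k, (dec m == Some k) && (k != i)],
              i \in C m & (r m < r j)%N]]]].

Definition zf_dof (K : nat) (dec : {ffun 'I_K -> option 'I_K}) : nat :=
  #|[set j | dec j != None]|.

Definition eta_zf (K L Nc : nat) : nat :=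
  \max_(x : {ffun 'I_K -> {set 'I_K}} *
            ({ffun 'I_K -> option 'I_K} * {ffun 'I_K -> 'I_K})
        | assoc_ok Nc x.1 && zf_valid L x.1 x.2.1 x.2.2)
     zf_dof x.2.1.

Definition tau_seq (L Nc : nat) : nat -> R :=
  fun K => (INR (eta_zf K L Nc) / INR K)%R.

(* Main.v *)
Require Import Defs.
From mathcomp Require Import all_boot.
From Stdlib Require Import Reals.
From Stdlib Require Import Lra.
From mathcomp Require Import zify.

(* List the active terminals as a_0 < a_1 < ... and let d_k be the station that
   decodes a_k.  Two terminals cannot each be heard at the station decoding the
   other, hence d is increasing and every step k is of type U (a_k < d_{k+1})
   or of type V (d_k + L < a_{k+1}).  All stations d_k hearing a_m must lie in
   C(a_m), so at most N of them do.  For the upper bound this yields two kinds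
   of jumps along d: "tiles" d_{x+N+1} >= d_x + L + 2, and, across a V-step that
   precedes a U-step, d_y >= d_x + L + (y - x).  Tiles realise the slope
   (L + 2) / (N + 1), and jumps of length at most 2 N a slope of at least
   (2 N + L) / (2 N); the point is that one can always chain such jumps.  The
   lower bounds come from explicit periodic schemes. *)

(** * Growth of an abstract chain of stations *)

Lemma incr_gap (f : nat -> nat) : (forall k, f k < f k.+1) ->
  forall i j, i <= j -> f i + (j - i) <= f j.
Proof.
move=> f_lt i j le_ij; rewrite -{2}(subnKC le_ij).
elim: (j - i) => [|n IHn]; first by rewrite !addn0.
by rewrite !addnS; have := f_lt (i + n); lia.
Qed.

(** The window has width [2 * N] because no jump is longer: the first one to pass [M] lands inside.
    The premise makes the claim vacuous beyond the window. *)
Definition slope_reach (p q N M : nat) (d : nat -> nat) (x : nat) : Prop :=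
  x <= M + 2 * N ->
  exists2 X, M <= X <= M + 2 * N & x <= X /\ d x * q + (X - x) * p <= d X * q.

Section Chain.

Context (L N p q M : nat) (d a : nat -> nat) (isV : pred nat).
Context (N_gt0 : 0 < N).
Context (d_lt : forall k, d k < d k.+1) (a_lt : forall k, a k < a k.+1).
Context (da : forall k, d k <= a k <= d k + L).
Context (stepV : forall k, isV k -> d k + L < a k.+1).
Context (stepU : forall k, ~~ isV k -> a k < d k.+1).
Context (window : forall s m, s <= m <= s + N -> (d s + L < a m) || (a m < d (s + N))).
Context (infV : forall k, exists k', (k <= k') && isV k').
Context (infU : forall k, exists k', (k <= k') && ~~ isV k').
Context (slopeT : (N + 1) * p <= (L + 2) * q).
Context (slopeJ : forall z, z <= 2 * N -> z * p <= (L + z) * q).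

Local Notation reach := (slope_reach p q N M d).

Definition tile x := d x + L + 2 <= d (x + N + 1).

(** The terminal [a x.+1] separates the ends: the V-step puts it beyond [d x + L], and the window
    starting at [x.+1] puts it below [d (x + N + 1)], because station [d x.+1] hears it. *)
Lemma tileV x : isV x -> tile x.
Proof.
move=> Vx; rewrite /tile; have := stepV _ Vx; have := da x.+1.
have := window (x.+1) (x.+1) ltac:(lia).
by rewrite addSn addn1; lia.
Qed.

(** Mirror image, with [a (x + N)] as separator: the U-step bounds it above, the window ending at
    [x + N] bounds it below. *)
Lemma tileU x : ~~ isV (x + N) -> tile x.
Proof.
move=> Ux; rewrite /tile; have := stepU _ Ux; have := da (x + N).
have := window (x) (x + N) ltac:(lia).
by rewrite addn1; lia.
Qed.

(* The first index below [u] whose station is too far from [a u] starts a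
   segment of length [N + 1] around [u]. *)
Lemma tile_around u : N <= u -> exists2 j, 0 < j <= N & tile (u - j).
Proof.
move=> le_Nu.
have exj : exists j, (j <= N) && (d (u - j) + L < a u).
  exists N; rewrite leqnn /=; have := da u.
  by have := window (u - N) (u) ltac:(lia); rewrite subnK //; lia.
case: (ex_minnP exj) => -[|j] /andP[le_jN far] min_j.
  by move: far (da u); rewrite subn0; lia.
exists j.+1; first by rewrite le_jN.
have near : ~~ (d (u - j) + L < a u).
  by apply/negP => far'; have := min_j j; rewrite far' andbT; lia.
have := window (u - j) (u) ltac:(lia); rewrite (negbTE near) /= /tile.
by rewrite (_ : u - j.+1 + N + 1 = u - j + N); lia.
Qed.

(** Follow [d] from [x] to [v.-1], cross to [a] by the V-step, gaining [L + 1], follow [a] to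
    [y.-1], and return to [d] by the U-step there. *)
Lemma jumpVU v x y : 0 < v -> isV v.-1 -> ~~ isV y.-1 -> x < v -> v < y ->
  d x + L + (y - x) <= d y.
Proof.
case: v y => [|v] [|y] // _ /= Vv Uy lt_xv lt_vy.
have := incr_gap d d_lt x v ltac:(lia).
have := incr_gap a a_lt v.+1 y ltac:(lia).
by have := stepV _ Vv; have := stepU _ Uy; lia.
Qed.

Lemma reach_ge x : M <= x -> reach x.
Proof. by move=> le_Mx le_x; exists x; rewrite ?le_Mx ?le_x ?leqnn //; split; lia. Qed.

Lemma reach_jump x y : x <= y <= x + 2 * N ->
  d x * q + (y - x) * p <= d y * q -> reach y -> reach x.
Proof.
move=> le_xy good_xy reach_y.
case: (leqP M x) => [|lt_xM]; first exact: reach_ge.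
move=> _; case: reach_y => [|X le_X [le_yX good_X]]; first by lia.
exists X => //; split; first by lia.
rewrite (_ : X - x = (y - x) + (X - y)) ?mulnDl; lia.
Qed.

Lemma reach_tile x : tile x -> reach (x + N + 1) -> reach x.
Proof.
rewrite /tile => Tx; apply: reach_jump; first by lia.
rewrite (_ : x + N + 1 - x = N + 1); last by lia.
have : (d x + L + 2) * q <= d (x + N + 1) * q by rewrite leq_mul2r Tx orbT.
by move: slopeT; rewrite !mulnDl; lia.
Qed.

Lemma reach_jumpVU v x y : 0 < v -> isV v.-1 -> ~~ isV y.-1 ->
  x < v -> v < y <= x + 2 * N -> reach y -> reach x.
Proof.
move=> v_gt0 Vv Uy lt_xv /andP[lt_vy le_y]; apply: reach_jump; first by lia.
have := slopeJ (y - x) ltac:(lia).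
have : (d x + L + (y - x)) * q <= d y * q.
  by rewrite leq_mul2r (jumpVU v x y v_gt0 Vv Uy lt_xv lt_vy) orbT.
by rewrite -addnA mulnDl; lia.
Qed.

(** Asking for [tile x] instead of [isV x] also covers a tile that starts in the U-run preceding the
    V-run that ends at [v]. *)
Definition junction_reach v := forall x, x < v <= x + N + 1 -> tile x -> reach x.

Lemma reachV u v : (forall k, u <= k < v -> isV k) -> junction_reach v ->
  forall y, u <= y < v -> reach y.
Proof.
move=> runV reach_v y; have [n] := ubnP (v - y); elim: n y => // n IHn y lt_n le_y.
have Ty : tile y by apply/tileV/runV.
case: (leqP v (y + N + 1)) => [le_v|lt_v]; first by apply: reach_v => //; lia.
by apply: reach_tile => //; apply: IHn; lia.
Qed.

Lemma reachU u v : (forall k, v <= k < u -> ~~ isV k) ->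
  forall w y, v <= y <= w -> w <= u -> y = w %[mod N + 1] -> reach w -> reach y.
Proof.
move=> runU w y le_yw le_wu /eqP; rewrite eq_sym eqn_mod_dvd; last by lia.
case/dvdnP=> k Dk reach_w.
elim: k y le_yw Dk => [|k IHk] y le_yw Dk; first by rewrite (_ : y = w) //; lia.
apply: reach_tile; first by apply/tileU/runU; lia.
by apply: IHk; lia.
Qed.

Lemma next_step (b : bool) k : exists2 u, k <= u & (isV u == b) /\
  forall i, k <= i < u -> isV i == ~~ b.
Proof.
have ex : exists u, (k <= u) && (isV u == b).
  by case: b; [case: (infV k) | case: (infU k)] => u /andP[le_u Hu]; exists u;
     rewrite le_u; case: (isV u) Hu.
case: (ex_minnP ex) => u /andP[le_u Hu] min_u; exists u => //; split=> // i /andP[le_i lt_i].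
have : ~~ (isV i == b) by apply/negP => Hi; have := min_u i; rewrite le_i Hi; lia.
by case: (isV i) (b) => [] [].
Qed.

(* Let [u] be the next V-step after [v].  Both [u] and the left end [u - j] of a
   tile around [u] can be continued; they lie in different classes modulo
   [N + 1], while among the residues modulo [N + 1] only one cannot be hit from
   [x] by a tile or by a jump over the junction [v]. *)
Lemma reach_junction v : 0 < v -> isV v.-1 -> ~~ isV v -> junction_reach v.
Proof.
(* If [x < M], then [v <= M + N], so the measure is positive and drops at the next junction. *)
have [n] := ubnP (M + N + 1 - v); elim: n v => // n IHn v lt_n v_gt0 Vv Uv x le_xv Tx.
case: (leqP M x) => [|lt_xM]; first exact: reach_ge.
have [u le_vu [/eqP Vu runU]] := next_step true v.
have lt_vu : v < u by rewrite ltn_neqAle le_vu andbT; apply/eqP => Evu; rewrite Evu Vu in Uv.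
have [w le_uw [/eqP Uw runV]] := next_step false u.
have lt_uw : u < w by rewrite ltn_neqAle le_uw andbT; apply/eqP => Euw; rewrite Euw Uw in Vu.
have {}runV k : u <= k < w -> isV k by move=> /runV /eqP.
have {}runU k : v <= k < u -> ~~ isV k by move=> /runU /eqP ->.
have reach_w : junction_reach w.
  by apply: IHn; rewrite ?Uw //; [lia | lia | apply: runV; lia].
have reach_u : reach u by apply: (reachV _ _ runV reach_w); lia.
(* The excluded value: if [v = x + N + 1], the tile from [x] hits [v] and only the jump to [v + N]
   exceeds [2 * N]; if [v] is closer, all jumps are short enough, but none can end at [v], which
   follows a V-step. *)
have from_x y : v <= y <= v + N -> y <= u -> (y == if v == x + N + 1 then v + N else v) = false ->
    reach y -> reach x.
  move=> le_vy le_yu; case: (v =P x + N + 1) => [Dv|nDv] neq_y reach_y.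
    case: (y =P v) => [Dy|nDy]; first by apply: reach_tile; rewrite -?Dv -?Dy.
    by apply: (reach_jumpVU v x y) => //; [apply: runU | |]; lia.
  by apply: (reach_jumpVU v x y) => //; [apply: runU | |]; lia.
case: (ltnP u (v + N)) => [lt_u|le_u].
  by apply: (from_x u) => //; try lia; case: ifP; lia.
have [j le_j Tj] := tile_around u ltac:(lia).
have reach_j : reach (u - j).
  (* As [j <= N], this tile ends beyond [u]: either within the V-run or so far that the next
     junction takes over. *)
  case: (leqP w (u - j + N + 1)) => [le_w|lt_w]; first by apply: reach_w => //; lia.
  by apply: reach_tile => //; apply: (reachV _ _ runV reach_w); lia.
pose rep z := v + (z - v) %% (N + 1).
have rep_reach z : v <= z <= u -> reach z -> [/\ v <= rep z <= v + N, rep z <= u & reach (rep z)].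
  move=> le_z reach_z; have lt_mod := @ltn_pmod (z - v) (N + 1) ltac:(lia).
  have le_mod := leq_mod (z - v) (N + 1).
  split; [rewrite /rep; lia | rewrite /rep; lia |].
  apply: (reachU _ _ runU z) => //; rewrite /rep; try lia.
  by rewrite modnDmr subnKC; lia.
have [le1 le1u reach1] := rep_reach u ltac:(lia) reach_u.
have [le2 le2u reach2] := rep_reach (u - j) ltac:(lia) reach_j.
have neq12 : rep u != rep (u - j).
  rewrite /rep eqn_add2l eqn_mod_dvd; last by lia.
  rewrite (_ : u - v - (u - j - v) = j); last by lia.
  by apply/negP => /dvdn_leq; lia.
set bad := (if v == x + N + 1 then v + N else v) in from_x.
case: (rep u =P bad) => [E1|/eqP/negbTE N1]; last exact: from_x N1 reach1.
apply: (from_x (rep (u - j))) => //.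
by apply/negbTE; rewrite -E1 eq_sym.
Qed.

(** Only U-steps precede the first V-step [u], so tiles lead from [u %% (N + 1)] up to [u]; this
    start costs at most [N] terminals. *)
Lemma chain_growth : exists x X,
  [/\ x <= N, x <= X, M <= X <= M + 2 * N & d x * q + (X - x) * p <= d X * q].
Proof.
have [u _ [/eqP Vu runU]] := next_step true 0.
have [w le_uw [/eqP Uw runV]] := next_step false u.
have lt_uw : u < w by rewrite ltn_neqAle le_uw andbT; apply/eqP => Euw; rewrite Euw Uw in Vu.
have {}runV k : u <= k < w -> isV k by move=> /runV /eqP.
have {}runU k : 0 <= k < u -> ~~ isV k by move=> /runU /eqP ->.
have reach_w : junction_reach w.
  by apply: reach_junction; rewrite ?Uw //; [lia | apply: runV; lia].
have reach_u : reach u by apply: (reachV _ _ runV reach_w); lia.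
have lt_mod := @ltn_pmod u (N + 1) ltac:(lia).
have : reach (u %% (N + 1)).
  by apply: (reachU _ _ runU u) => //; rewrite ?leq_mod ?modn_mod.
case=> [|X le_X [le_x good_x]]; first by lia.
by exists (u %% (N + 1)), X; split=> //; lia.
Qed.

End Chain.

(** * Order constraints on decoding pairs *)

Section Scheme.

Context (K L : nat) (C : {ffun 'I_K -> {set 'I_K}}).
Context (dec : {ffun 'I_K -> option 'I_K}) (r : {ffun 'I_K -> 'I_K}).
Context (dec_ok : zf_valid L C dec r).

Lemma zf_connected j i : dec j = Some i -> (i \in C j) /\ i <= j <= i + L.
Proof.
move=> Dj; move/forallP/(_ j)/forallP/(_ i): dec_ok.
by rewrite Dj eqxx /= => /and3P[].
Qed.

Lemma zf_cancelled j i m : dec j = Some i -> dec m != None -> m != j ->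
  i <= m <= i + L -> (i \in C m) /\ r m < r j.
Proof.
move=> Dj am neq_mj con; move/forallP/(_ j)/forallP/(_ i): dec_ok.
rewrite Dj eqxx /= => /and3P[_ _ /forallP/(_ m)].
by rewrite neq_mj am /connected con /= => /and3P[].
Qed.

(** Each of the two decodings would have to come before the other. *)
Lemma zf_not_mutual j i m k : dec j = Some i -> dec m = Some k -> m != j ->
  i <= m <= i + L -> k <= j <= k + L -> False.
Proof.
move=> Dj Dm neq_mj mi jk.
have [_ lt1] := zf_cancelled j i m Dj ltac:(by rewrite Dm) neq_mj mi.
have [_ lt2] := zf_cancelled m k j Dm ltac:(by rewrite Dj) ltac:(by rewrite eq_sym) jk.
lia.
Qed.

(** A crossing [k <= i <= j < m] would put both terminals in range of both stations. *)
Lemma zf_monotone j i m k : dec j = Some i -> dec m = Some k -> j < m -> i < k.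
Proof.
move=> Dj Dm lt_jm; rewrite ltnNge; apply/negP => le_ki.
have [_ ij] := zf_connected j i Dj; have [_ km] := zf_connected m k Dm.
by apply: (zf_not_mutual j i m k Dj Dm); rewrite -?val_eqE /=; lia.
Qed.

Lemma zf_step j i m k : dec j = Some i -> dec m = Some k -> j < m ->
  (i + L < m) || (j < k).
Proof.
move=> Dj Dm lt_jm; apply/negP => /negP/norP[ge1 ge2].
have [_ ij] := zf_connected j i Dj; have [_ km] := zf_connected m k Dm.
by apply: (zf_not_mutual j i m k Dj Dm); rewrite -?val_eqE /=; lia.
Qed.

Lemma zf_station_in_C j i m : dec j = Some i -> dec m != None ->
  i <= m <= i + L -> i \in C m.
Proof.
move=> Dj am con; case: (eqVneq m j) => [->|neq].
  by case: (zf_connected j i Dj).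
by case: (zf_cancelled j i m Dj am neq con).
Qed.

End Scheme.

(** * Upper bound on the number of active terminals *)

Lemma zf_dof_upper (K L N p q : nat) C dec r :
  0 < N -> (N + 1) * p <= (L + 2) * q ->
  (forall z, z <= 2 * N -> z * p <= (L + z) * q) ->
  assoc_ok N C -> zf_valid L C dec r ->
  @zf_dof K dec * p <= K * q + ((L + 2 * N * (L + 1)) * q + N * p).
Proof.
case: K C dec r => [|K] C dec r N_gt0 slopeT slopeJ C_ok dec_ok.
  by rewrite (_ : zf_dof _ = 0) //; apply/eqP; rewrite cards_eq0; apply/eqP/setP => -[].
pose act := [seq j <- enum 'I_K.+1 | dec j != None]; set n := zf_dof dec.
have size_act : size act = n.
  by rewrite /n /zf_dof cardsE cardE /act /enum_mem -filter_predI; congr size; apply: eq_filter => j; rewrite /= andbT.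
pose c k := nth ord0 act k; pose e k := odflt ord0 (dec (c k)).
have dec_c k : k < n -> dec (c k) = Some (e k).
  rewrite -size_act => lt_k; have := mem_nth ord0 lt_k; rewrite mem_filter /e /c.
  by case: (dec _).
have c_lt k l : k < l < n -> c k < c l.
  case/andP=> lt_kl lt_ln.
  have srt : sorted (fun i j : 'I_K.+1 => i < j) act.
    apply: sorted_filter; first by move=> x y z; apply: ltn_trans.
    by have := iota_ltn_sorted 0 K.+1; rewrite -val_enum_ord sorted_map.
  apply: (sorted_ltn_nth _ _ srt) => //; rewrite ?inE ?size_act //; last by lia.
  by move=> x y z; apply: ltn_trans.
have e_c k : k < n -> e k <= c k <= e k + L.
  by move=> /dec_c; case/(zf_connected _ _ _ _ _ dec_ok).
have e_lt k l : k < l < n -> e k < e l.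
  move=> lt_kl; apply: (zf_monotone _ _ _ _ _ dec_ok (c k) (e k) (c l) (e l) _ _ (c_lt _ _ lt_kl));
  by apply: dec_c; lia.
(* Past the last active terminal the chain is continued by points so far apart
   that all steps are of both types, hence their types can be made to alternate. *)
pose far k := K.+1 + L + (k - n) * (L + 1).
pose a k := if k < n then nat_of_ord (c k) else far k.
pose d k := if k < n then nat_of_ord (e k) else far k.
have bound k : (c k < K.+1) /\ (e k < K.+1) by split; apply: ltn_ord.
have farS k : n <= k -> far k.+1 = far k + L + 1.
  by move=> le_nk; rewrite /far subSn // mulSn; lia.
have far_ge k : K.+1 + L <= far k by rewrite /far leq_addr.
pose isV k := if k.+1 < n then d k + L < a k.+1 else odd k.
have d_lt k : d k < d k.+1.
  rewrite /d; have := e_lt k k.+1; have := bound k; have := farS k; have := far_ge k.+1.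
  by case: (ltnP k.+1 n); case: (ltnP k n); lia.
have a_lt k : a k < a k.+1.
  rewrite /a; have := c_lt k k.+1; have := bound k; have := farS k; have := far_ge k.+1.
  by case: (ltnP k.+1 n); case: (ltnP k n); lia.
have last_step k : n <= k.+1 -> (d k + L < a k.+1) && (a k < d k.+1).
  move=> le_n; rewrite /a /d [k.+1 < n]ltnNge le_n /=.
  have := bound k; have := farS k; have := far_ge k.+1.
  by case: (ltnP k n); lia.
have da k : d k <= a k <= d k + L.
  by rewrite /a /d; case: ltnP => [/e_c //|_]; rewrite leqnn leq_addr.
have stepV k : isV k -> d k + L < a k.+1.
  by rewrite /isV; case: ltnP => // /last_step/andP[].
have stepU k : ~~ isV k -> a k < d k.+1.
  rewrite /isV; case: ltnP => [lt_k|/last_step/andP[//]].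
  rewrite /d /a lt_k (ltnW lt_k) => /negPf not_far.
  have := @zf_step _ _ _ _ _ dec_ok (c k) (e k) (c k.+1) (e k.+1).
  by rewrite not_far /=; apply; rewrite ?dec_c ?c_lt //; lia.
have window s m : s <= m <= s + N -> (d s + L < a m) || (a m < d (s + N)).
  move=> /andP[le_sm le_mt].
  case: (ltnP (s + N) n) => [lt_t|le_nt].
    apply/negPn; rewrite negb_or; apply/negP.
    have [lt_s lt_m] : s < n /\ m < n by lia.
    rewrite /d /a lt_s lt_m lt_t => far_sm.
    (* If the window property failed, the [N + 1] stations [e s, ..., e (s + N)] would all hear
       [c m]. *)
    have inC : [set e (s + i) | i : 'I_N.+1] \subset C (c m).
      apply/subsetP => _ /imsetP[i _ ->]; have lt_i := ltn_ord i.
      apply: (zf_station_in_C _ _ _ _ _ dec_ok (c (s + i))); rewrite ?dec_c //; try lia.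
      have := e_lt s (s + i); have := e_lt (s + i) (s + N).
      case: (posnP i) => [->|i_gt0]; rewrite ?addn0; first by lia.
      case: (eqVneq (nat_of_ord i) N) => [->|neq_i]; first by lia.
      by move: neq_i => /eqP; lia.
    have := leq_trans (subset_leq_card inC) (forallP C_ok (c m)).
    rewrite card_imset ?card_ord ?ltnn // => i j /(congr1 val) /= Eij; apply: val_inj => /=.
    have := e_lt (s + i) (s + j); have := e_lt (s + j) (s + i).
    by have := ltn_ord i; have := ltn_ord j; case: (ltngtP i j); lia.
  (* Windows leaving the real chain: use the U-type of step [m] or the remoteness of the added
     points if [m < s + N], and the V-type of the last step if [m = s + N]. *)
  have d_gap := incr_gap d d_lt.
  case: (ltnP m (s + N)) => [lt_mt|le_tm].
    case: (ltnP m.+1 n) => [lt_m|/last_step/andP[_ lt_a]]; last first.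
      by have := d_gap m.+1 (s + N) lt_mt; lia.
    rewrite /a /d (ltnW lt_m) [s + N < n]ltnNge le_nt /=.
    by have := bound m; have := far_ge (s + N); lia.
  have Dm : m = (s + N).-1.+1 by lia.
  have /andP[] := last_step (s + N).-1 ltac:(lia).
  by have := d_gap s (s + N).-1 ltac:(lia); rewrite -Dm; lia.
have inf (b : bool) k : exists k', (k <= k') && (isV k' == b).
  exists ((n + k).*2 + b); apply/andP; split; first by lia.
  by rewrite /isV ifN ?oddD ?odd_double; [case: b | lia].
have infV k : exists k', (k <= k') && isV k'.
  by have [k'] := inf true k; rewrite eqb_id; exists k'.
have infU k : exists k', (k <= k') && ~~ isV k'.
  by have [k'] := inf false k; rewrite eqbF_neg; exists k'.
have [x [X [le_xN le_xX le_X growth]]] :=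
  chain_growth L N p q n d a isV N_gt0 d_lt a_lt da stepV stepU window infV infU slopeT slopeJ.
(* With [M = n], [X] is at most [2 * N] added points past [n], spaced by [L + 1]. *)
have d_X : d X * q <= (K.+1 + (L + 2 * N * (L + 1))) * q.
  rewrite leq_mul2r /d ifN; last by lia.
  rewrite /far -addnA !leq_add2l leq_mul2r; lia.
have : n * p <= (X - x) * p + N * p by rewrite -mulnDl leq_mul2r; lia.
by move: d_X growth; rewrite mulnDl; lia.
Qed.

Lemma eta_zf_upper (K L N p q : nat) :
  0 < N -> (N + 1) * p <= (L + 2) * q ->
  (forall z, z <= 2 * N -> z * p <= (L + z) * q) ->
  eta_zf K L N * p <= K * q + ((L + 2 * N * (L + 1)) * q + N * p).
Proof.
move=> N_gt0 slopeT slopeJ; rewrite /eta_zf.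
elim/big_ind: _ => [|x y|x /andP[C_ok dec_ok]]; rewrite ?mul0n ?maxnMl ?geq_max //.
  by move=> -> ->.
exact: zf_dof_upper C_ok dec_ok.
Qed.

(** * Lower bounds from explicit schemes *)

Lemma eta_zf_ge (K L N : nat) (dec : {ffun 'I_K -> option 'I_K}) (r : {ffun 'I_K -> 'I_K}) :
  (forall j i, dec j = Some i -> i <= j <= i + L) ->
  (forall j i m k, dec j = Some i -> dec m = Some k -> m != j ->
     i <= m <= i + L -> r m < r j) ->
  (forall m, dec m != None ->
     #|[set i : 'I_K | (i <= m <= i + L) && [exists j, dec j == Some i]]| <= N) ->
  zf_dof dec <= eta_zf K L N.
Proof.
move=> con ord deg.
(* The smallest admissible association: an active terminal gets just the stations in use that hear
   it. *)
pose C := [ffun m => if dec m == None then set0 else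
  [set i : 'I_K | (i <= m <= i + L) && [exists j, dec j == Some i]]].
rewrite /eta_zf (bigmax_sup (C, (dec, r))) //=; apply/andP; split.
  apply/forallP => m; rewrite ffunE; case: eqP => [_|/eqP/deg //].
  by rewrite cards0.
apply/forallP => j; apply/forallP => i; apply/implyP => /eqP Dj.
have ex_i : [exists j, dec j == Some i] by apply/existsP; exists j; rewrite Dj.
rewrite ffunE Dj /= inE ex_i (con j i Dj) /connected (con j i Dj) /=.
apply/forallP => m; apply/implyP => /and3P[neq_mj mi].
case Dm: (dec m) => [k|] // _; have lt_mj := ord j i m k Dj Dm neq_mj mi.
rewrite lt_mj ffunE Dm /= inE ex_i mi andbT /= andbT.
(* Two terminals decoded at the same station would each have to precede the other. *)
apply/existsP; exists k; rewrite eqxx /=; apply/eqP => Eki.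
have := ord m k j i Dm Dj; rewrite eq_sym neq_mj Eki (con j i Dj); lia.
Qed.

Lemma card_le_size (T : finType) (A : {set T}) (f : T -> nat) (s : seq nat) :
  {in A &, injective f} -> (forall x, x \in A -> f x \in s) -> #|A| <= size s.
Proof.
move=> f_inj f_s; rewrite cardE -(size_map f); apply: uniq_leq_size.
  by rewrite map_inj_in_uniq ?enum_uniq // => x y; rewrite !mem_enum; apply: f_inj.
by move=> _ /mapP[x xA ->]; apply: f_s; rewrite -mem_enum.
Qed.

Lemma eta_zf_le (K L N : nat) : eta_zf K L N <= K.
Proof.
by apply/bigmax_leqP => x _; rewrite (leq_trans (max_card _)) ?card_ord.
Qed.

(** Each terminal is decoded at the station of its own index, from the last to the first; at most
    [L + 1] stations hear it. *)
Lemma eta_zf_full (K L N : nat) : L < N -> K <= eta_zf K L N.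
Proof.
move=> lt_LN; pose dec : {ffun 'I_K -> option 'I_K} := [ffun j => Some j].
pose r : {ffun 'I_K -> 'I_K} := [ffun j => rev_ord j].
suff : zf_dof dec <= eta_zf K L N.
  apply: leq_trans; rewrite /zf_dof (_ : [set j | _] = setT) ?cardsT ?card_ord //.
  by apply/setP => j; rewrite !inE ffunE.
apply: (@eta_zf_ge _ _ _ _ r) => [j i|j i m k|m _].
- by rewrite ffunE => -[->]; lia.
- rewrite !ffunE => -[->] [_]; rewrite -val_eqE /= => neq_mj; have := ltn_ord m; lia.
- apply: leq_trans lt_LN; rewrite -(size_iota (m - L) L.+1).
  apply: (@card_le_size _ _ (@nat_of_ord K)); first by move=> x y _ _; apply: val_inj.
  by move=> i; rewrite inE mem_iota; lia.
Qed.

Lemma divmod_block p t o : o < p -> (t * p + o) %/ p = t /\ (t * p + o) %% p = o.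
Proof.
move=> lt_op; have p_gt0 : 0 < p by lia.
by rewrite divnMDl // divn_small // addn0 modnMDl modn_small.
Qed.

Lemma block_cmp p t t' : [\/ t = t', t * p + p <= t' * p /\ t < t' | t' * p + p <= t * p /\ t' < t].
Proof.
have step x y : x < y -> x * p + p <= y * p by move=> lt; rewrite addnC -mulSn leq_mul2r lt orbT.
by case: (ltngtP t t') => [lt|lt|eq]; [constructor 2 | constructor 3 | constructor 1]; auto.
Qed.

(* [g o = Some b]: in every block of [p] consecutive indices, the terminal at
   offset [o] is decoded at the station at offset [b].  Blocks are decoded from
   the last to the first, and [rho] orders the offsets of one block. *)
Lemma eta_zf_blocks (K L N p : nat) (g : nat -> option nat) (rho : nat -> nat) (s : seq nat) :
  L < p ->
  (forall o b, g o = Some b -> b <= o <= b + L) ->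
  (forall o, o < p -> rho o < p) ->
  (forall o b o' b', g o = Some b -> g o' = Some b' -> o < p -> o' < p ->
     o' != o -> b <= o' <= b + L -> rho o' < rho o) ->
  (forall o, o < p -> g o != None -> exists2 S : seq nat, size S <= N &
     forall o' b, o' < p -> g o' = Some b ->
       (b <= o <= b + L) || (p + o <= b + L) -> b \in S) ->
  uniq s -> (forall o, o \in s -> (o < p) && (g o != None)) ->
  K %/ p * size s <= eta_zf K L N.
Proof.
move=> lt_Lp g_con rho_lt g_ord g_deg s_uniq s_g.
have p_gt0 : 0 < p by lia.
set T := K %/ p.
have le_TK : T * p <= K by apply: leq_divM.
pose dec : {ffun 'I_K -> option 'I_K} := [ffun j : 'I_K =>
  if j %/ p < T then obind (fun b => insub (j %/ p * p + b)) (g (j %% p)) else None].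
have dec_def j i : dec j = Some i -> exists t o b,
    [/\ t < T, o < p, g o = Some b, nat_of_ord j = t * p + o & nat_of_ord i = t * p + b].
  rewrite ffunE; case: ifP => // lt_t; case Dg: (g _) => [b|] //=.
  case: insubP => // i' _ Di [<-]; exists (j %/ p), (j %% p), b.
  by split; rewrite ?ltn_pmod -?divn_eq.
have block_lt t o : t < T -> o < p -> t * p + o < K.
  by move=> lt_t lt_o; case: (block_cmp p t T) => [|[]|[]]; lia.
pose rk (j : nat) := (T.-1 - j %/ p) * p + rho (j %% p).
have rkE t o : o < p -> rk (t * p + o) = (T.-1 - t) * p + rho o.
  by move=> /(divmod_block p t)[Dt Do]; rewrite /rk Dt Do.
(* The default [j] can occur only outside the complete blocks, where terminals are silent. *)
pose r : {ffun 'I_K -> 'I_K} := [ffun j : 'I_K => insubd j (rk j)].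
have rE (j : 'I_K) t o : t < T -> o < p -> nat_of_ord j = t * p + o ->
    nat_of_ord (r j) = (T.-1 - t) * p + rho o.
  move=> lt_t lt_o Dj; rewrite ffunE val_insubd Dj rkE // block_lt //; first by lia.
  exact: rho_lt.
have dof : T * size s <= zf_dof dec.
  pose at_ (x : 'I_T * 'I_(size s)) := x.1 * p + nth 0 s x.2.
  have nth_lt (x : 'I_(size s)) := s_g _ (mem_nth 0 (ltn_ord x)).
  have at_lt x : at_ x < K by apply: block_lt => //; case/andP: (nth_lt x.2).
  have at_inj : injective (fun x => Ordinal (at_lt x)).
    move=> [t x] [t' x'] /(congr1 val) /=; rewrite /at_ /= => E.
    have /andP[lt_x _] := nth_lt x; have /andP[lt_x' _] := nth_lt x'.
    have [Dt Do] := divmod_block p t _ lt_x; have [Dt' Do'] := divmod_block p t' _ lt_x'.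
    congr pair; apply: val_inj => /=; first by rewrite -Dt -Dt' E.
    by apply/eqP; rewrite -(nth_uniq 0 _ _ s_uniq) // -Do -Do' E.
  rewrite -{1}(card_ord T) -(card_ord (size s)) -card_prod -(card_imset _ at_inj).
  apply/subset_leq_card/subsetP => _ /imsetP[x _ ->]; rewrite inE ffunE /= /at_.
  have /andP[lt_x g_x] := nth_lt x.2; have [-> ->] := divmod_block p x.1 _ lt_x.
  rewrite ltn_ord; case Dg: (g _) g_x => [b|] //= _.
  have := g_con _ _ Dg; have := block_lt x.1 b (ltn_ord _) => lt_b le_b.
  by rewrite insubT //; apply: lt_b; lia.
apply: (leq_trans dof); apply: (@eta_zf_ge _ _ _ _ r).
- by move=> j i /dec_def[t [o [b [_ _ /g_con le_o -> ->]]]]; lia.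
- move=> j i m k /dec_def[t [o [b [lt_t lt_o Dg Dj ->]]]].
  move=> /dec_def[t' [o' [b' [lt_t' lt_o' Dg' Dm _]]]].
  rewrite -val_eqE /= (rE j t o) // (rE m t' o') // Dj Dm.
  have := g_con _ _ Dg; have := g_con _ _ Dg'; have := rho_lt _ lt_o; have := rho_lt _ lt_o'.
  case: (block_cmp p t t') => [<-|[le lt]|[le lt]]; try lia.
    by have := g_ord o b o' b' Dg Dg' lt_o lt_o'; rewrite eqn_add2l; lia.
  by case: (block_cmp p (T.-1 - t') (T.-1 - t)) => [|[]|[]]; lia.
move=> m; case Dm: (dec m) => [k|] // _.
have {Dm} [t [o [b [lt_t lt_o Dg Dm _]]]] := dec_def _ _ Dm.
have [S le_S inS] := g_deg o lt_o ltac:(by rewrite Dg).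
(* Stations hearing [m] differ by at most [L < p], so offsets tell them apart. *)
apply: leq_trans le_S; apply: (@card_le_size _ _ (fun i : 'I_K => i %% p)).
  move=> i i'; rewrite !inE => /andP[le_i _] /andP[le_i' _] E; apply: val_inj => /=.
  rewrite [LHS](divn_eq i p) [RHS](divn_eq i' p) E.
  have := divn_eq i p; have := divn_eq i' p; rewrite E.
  by case: (block_cmp p (i %/ p) (i' %/ p)) => [->|[]|[]]; lia.
move=> i; rewrite inE => /andP[le_i /existsP[j /eqP/dec_def]].
case=> t' [o' [b' [lt_t' lt_o' Dg' _ Di]]]; have le_b' := g_con _ _ Dg'.
rewrite Di; have [_ ->] := divmod_block p t' b' ltac:(lia).
(* A station of an earlier block gives the second alternative of [g_deg]; one of a later block
   cannot hear [m]. *)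
apply: (inS _ _ lt_o' Dg'); move: le_i; rewrite Di Dm.
by case: (block_cmp p t t') => [->|[le lt]|[le lt]]; lia.
Qed.

(** In each period [L + 2], offsets below [N] use their own stations and offset [L + 1] uses station
    [N]. Higher offsets are decoded first. *)
Lemma eta_zf_lower_dense (K L N : nat) : 0 < N <= L ->
  K * (N + 1) <= eta_zf K L N * (L + 2) + (L + 2) * (N + 1).
Proof.
move=> le_N.
pose g o := if o < N then Some o else if o == L + 1 then Some N else None.
have gP o b : g o = Some b -> (o < N /\ b = o) \/ (o = L + 1 /\ b = N).
  by rewrite /g; case: ltnP => [? [<-]|_]; [left | case: eqP => // -> [<-]; right].
have eta_ge : K %/ (L + 2) * (N + 1) <= eta_zf K L N.
  have -> : N + 1 = size (rcons (iota 0 N) (L + 1)) by rewrite size_rcons size_iota addn1.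
  apply: (eta_zf_blocks _ _ _ _ g (fun o => L + 1 - o)).
  - by lia.
  - by move=> o b /gP; lia.
  - by move=> o; lia.
  - by move=> o b o' b' /gP + /gP; lia.
  - move=> o lt_o; case Dg: (g o) => [b|] // _; move/gP: Dg => Dg.
    (* Stations [0..o] of the same block and [o + 2..N] of the previous one hear offset [o < N]: of
       the [N + 1] in use, only [o + 1] is missed. *)
    exists (if o < N then iota 0 o.+1 ++ iota o.+2 (N - o.+1) else iota 1 N).
      by case: ltnP; rewrite ?size_cat !size_iota; lia.
    move=> o' b' _ /gP Dg'; case: ltnP => lt_oN; rewrite ?mem_cat !mem_iota; lia.
  - by rewrite rcons_uniq iota_uniq mem_iota; lia.
  - move=> o; rewrite mem_rcons inE mem_iota /g => /orP[/eqP->|lt_o].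
      by rewrite eqxx; case: ifP => _ /=; rewrite andbT; lia.
    by rewrite (_ : o < N) /= ?andbT; lia.
have := divn_eq K (L + 2); have := @ltn_pmod K (L + 2) ltac:(lia).
move: (K %/ _) (K %% _) eta_ge => T m eta_ge lt_m DK.
have : T * (N + 1) * (L + 2) <= eta_zf K L N * (L + 2) by rewrite leq_mul2r eta_ge orbT.
have : m * (N + 1) <= (L + 2) * (N + 1) by rewrite leq_mul2r (ltnW lt_m) orbT.
have -> : K * (N + 1) = T * (N + 1) * (L + 2) + m * (N + 1) by rewrite {1}DK mulnDl mulnAC.
lia.
Qed.

(** In each period, [L] silent offsets isolate the block from the previous one. The next [N] use
    stations [L] lower, in increasing order; the last [N] use their own, in decreasing order.
    Neither group is heard at the stations of the other. *)
Lemma eta_zf_lower_sparse (K L N : nat) : 0 < N ->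
  K * (2 * N) <= eta_zf K L N * (2 * N + L) + (2 * N + L) * (2 * N).
Proof.
move=> N_gt0; set p := 2 * N + L.
pose g o := if o < L then None else if o < L + N then Some (o - L) else Some o.
have gP o b : g o = Some b -> (L <= o < L + N /\ b = o - L) \/ (L + N <= o /\ b = o).
  by rewrite /g; case: ltnP => // ?; case: ltnP => ? [<-]; [left | right].
have eta_ge : K %/ p * (2 * N) <= eta_zf K L N.
  have -> : 2 * N = size (iota L (2 * N)) by rewrite size_iota.
  apply: (eta_zf_blocks _ _ _ _ g (fun o => if o < L + N then o else L + N + (p.-1 - o))).
  - by rewrite /p; lia.
  - by move=> o b /gP; lia.
  - by move=> o; rewrite /p; case: ifP; lia.
  - by move=> o b o' b' /gP + /gP; rewrite /p; do 2![case: ifP]; lia.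
  - move=> o lt_o; case Dg: (g o) => [b|] // _; move/gP: Dg => Dg.
    exists (if o < L + N then iota 0 N else iota (L + N) N).
      by case: ltnP; rewrite size_iota.
    move=> o' b' lt_o' /gP Dg'; case: ltnP => lt_oN; rewrite mem_iota; rewrite /p in lt_o lt_o' *; lia.
  - exact: iota_uniq.
  - move=> o; rewrite mem_iota /g /p => lt_o; case: ifP; first by lia.
    by case: ifP => _ _ /=; rewrite andbT; lia.
have := divn_eq K p; have := @ltn_pmod K p ltac:(rewrite /p; lia).
move: (K %/ _) (K %% _) eta_ge => T m eta_ge lt_m DK.
have : T * (2 * N) * p <= eta_zf K L N * p by rewrite leq_mul2r eta_ge orbT.
have : m * (2 * N) <= p * (2 * N) by rewrite leq_mul2r (ltnW lt_m) orbT.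
have -> : K * (2 * N) = T * (2 * N) * p + m * (2 * N) by rewrite {1}DK mulnDl mulnAC.
lia.
Qed.

(** * Passage to the limit and the three regimes *)

Lemma tau_seq_cv (L N p q c : nat) : 0 < p ->
  (forall K, K * q <= eta_zf K L N * p + c) ->
  (forall K, eta_zf K L N * p <= K * q + c) ->
  Un_cv (tau_seq L N) (INR q / INR p)%R.
Proof.
move=> p_gt0 lower upper eps eps_gt0.
have p_pos : (0 < INR p)%R by apply: lt_0_INR; lia.
have [k lt_k] := INR_unbounded (INR c / (INR p * eps))%R.
exists k.+1 => K le_kK.
have lt_K : (INR c / (INR p * eps) < INR K)%R.
  by apply: (Rlt_le_trans _ _ _ lt_k); apply: le_INR; lia.
have K_pos : (0 < INR K)%R by apply: lt_0_INR; lia.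
have le1 : (INR K * INR q <= INR (eta_zf K L N) * INR p + INR c)%R.
  rewrite -!mult_INR -plus_INR; apply: le_INR; have := lower K; lia.
have le2 : (INR (eta_zf K L N) * INR p <= INR K * INR q + INR c)%R.
  rewrite -!mult_INR -plus_INR; apply: le_INR; have := upper K; lia.
rewrite /R_dist /tau_seq.
have -> : (INR (eta_zf K L N) / INR K - INR q / INR p =
  (INR (eta_zf K L N) * INR p - INR K * INR q) / (INR K * INR p))%R by field; lra.
have KP : (0 < INR K * INR p)%R by apply: Rmult_lt_0_compat.
rewrite Rabs_mult Rabs_inv (Rabs_pos_eq (INR K * INR p)); last by lra.
apply: (Rmult_lt_reg_r (INR K * INR p)) => //.
rewrite Rmult_assoc Rinv_l ?Rmult_1_r; last by lra.
have lt_c : (INR c < eps * (INR K * INR p))%R.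
  have pe : (0 < INR p * eps)%R by apply: Rmult_lt_0_compat.
  have := Rmult_lt_compat_r _ _ _ pe lt_K.
  by rewrite /Rdiv Rmult_assoc Rinv_l; lra.
by apply: Rle_lt_trans lt_c; apply: Rabs_le; lra.
Qed.

Theorem theorem1 (L Nc : nat) :
  (1 <= L)%N -> (1 <= Nc)%N ->
  [/\ (L + 1 <= Nc)%N -> Un_cv (tau_seq L Nc) 1%R,
      (L <= 2 * Nc)%N && (Nc <= L)%N ->
        Un_cv (tau_seq L Nc) (INR (Nc + 1) / INR (L + 2))%R &
      (2 * Nc < L)%N ->
        Un_cv (tau_seq L Nc) (INR (2 * Nc) / INR (2 * Nc + L))%R].
Proof.
move=> L_gt0 N_gt0; split=> [lt_LN | /andP[le_L2N le_NL] | lt_2NL].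
- have -> : 1%R = (INR 1 / INR 1)%R by rewrite /= Rdiv_1_r.
  apply: (tau_seq_cv _ _ _ _ 0) => // K.
    by have := eta_zf_full K L Nc; lia.
  by have := eta_zf_le K L Nc; lia.
- set c1 := (L + 2) * (Nc + 1).
  set c2 := (L + 2 * Nc * (L + 1)) * (Nc + 1) + Nc * (L + 2).
  apply: (tau_seq_cv _ _ _ _ (c1 + c2)) => [|K|K]; first by lia.
    by have := eta_zf_lower_dense K L Nc; rewrite -/c1; lia.
  have slopeJ z : z <= 2 * Nc -> z * (L + 2) <= (L + z) * (Nc + 1).
    move=> le_z.
    (* The worst case is [z = 2 * Nc], where the slack is [(Nc - 1) * (2 * Nc - L)]. *)
    have : z * (L + 1 - Nc) <= 2 * Nc * (L + 1 - Nc) by rewrite leq_mul2r le_z orbT.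
    by nia.
  by have := eta_zf_upper K L Nc _ _ N_gt0 ltac:(by rewrite mulnC) slopeJ; rewrite -/c2; lia.
- set c1 := (2 * Nc + L) * (2 * Nc).
  set c2 := (L + 2 * Nc * (L + 1)) * (2 * Nc) + Nc * (2 * Nc + L).
  apply: (tau_seq_cv _ _ _ _ (c1 + c2)) => [|K|K]; first by lia.
    by have := eta_zf_lower_sparse K L Nc N_gt0; rewrite -/c1; lia.
  (* Here tiles have slack [(Nc - 1) * (L - 2 * Nc)], and jumps of length [2 * Nc] are tight. *)
  have slopeT : (Nc + 1) * (2 * Nc + L) <= (L + 2) * (2 * Nc) by nia.
  have slopeJ z : z <= 2 * Nc -> z * (2 * Nc + L) <= (L + z) * (2 * Nc) by nia.
  by have := eta_zf_upper K L Nc _ _ N_gt0 slopeT slopeJ; rewrite -/c2; lia.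
Qed.
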